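(* Let $q$ be a prime power. Then: (1) if $q\geq 5$, then $M_{q-k}\bigl((q-k)(q-2)+2\bigr)=q+1$ for every integer $k$ with $0\leq k\leq \lfloor q/2\rfloor-1$; (2) if $q\geq 3$, then $M_{q-1}\bigl((q-1)^2+1\bigr)=q+2$.
   Context: For integers $c,s\geq 1$, $K_{c\times s}$ denotes the complete multipartite graph with $c$ classes of $s$ vertices each. For a subgraph $H$ of $K_{c\times s}$, $\overline{H}$ denotes the complement of $H$ relative to $K_{c\times s}$. $C_4$ is the $4$-cycle and $K_{1,n}$ is the star with $n+1$ vertices. $M_s(n)$ is the smallest positive integer $c$ such that for every subgraph $H$ of $K_{c\times s}$, $H$ contains a copy of $C_4$ or $\overline{H}$ contains a copy of $K_{1,n}$. *)

(* Defs.v *)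
From mathcomp Require Import all_boot.
Set Implicit Arguments.
Unset Strict Implicit.
Unset Printing Implicit Defensive.

(* A graph on a finite vertex type is given by its boolean adjacency relation. *)
Definition simple_graph (V : finType) (e : rel V) : Prop :=
  symmetric e /\ irreflexive e.

(* Subgraphs are taken spanning (determined by their edges): neither C_4 nor
   K_{1,n} with n >= 1 has an isolated vertex, so the vertex set of a
   subgraph does not matter for containing a copy of them. *)
Definition subgraph (V : finType) (h e : rel V) : Prop :=
  simple_graph h /\ subrel h e.

Definition rel_complement (V : finType) (e h : rel V) : rel V :=
  [rel x y | e x y && ~~ h x y].

(* Copies are not required to be induced. *)
Definition contains_copy (V W : finType) (e : rel V) (g : rel W) : Prop :=
  exists2 f : W -> V, injective f & forall x y : W, g x y -> e (f x) (f y).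

(* (i, a) is the a-th vertex of the i-th class. *)
Definition complete_multipartite (c s : nat) : rel ('I_c * 'I_s) :=
  [rel x y | x.1 != y.1].

(* ordS is the cyclic successor on 'I_4. *)
Definition C4 : rel 'I_4 := [rel i j | (j == ordS i) || (i == ordS j)].

(* K_{1,n}, with centre ord0. *)
Definition star (n : nat) : rel 'I_n.+1 :=
  [rel i j | (i == ord0) (+) (j == ord0)].

Definition C4_star_arrow (s n c : nat) : Prop :=
  forall h : rel ('I_c * 'I_s),
    subgraph h (@complete_multipartite c s) ->
    contains_copy h C4 \/
    contains_copy (rel_complement (@complete_multipartite c s) h) (@star n).

(* is_M s n c says that M_s(n) exists and equals c. *)
Definition is_M (s n c : nat) : Prop :=
  [/\ 0 < c, C4_star_arrow s n c
    & forall c' : nat, 0 < c' -> C4_star_arrow s n c' -> c <= c'].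

Definition prime_power (q : nat) : Prop :=
  exists p m : nat, [/\ prime p, 0 < m & q = p ^ m].

(* Main.v *)
Require Import Defs.
From mathcomp Require Import all_boot.
From mathcomp Require Import all_algebra all_field zify ring.

Set Implicit Arguments.
Unset Strict Implicit.
Unset Printing Implicit Defensive.

Import GRing.Theory.

(** A graph [H] inside [K_{c x s}] has no [K_{1,n}] in its complement iff its
    minimum degree is at least [d = s(c-1)+1-n].  If [H] is moreover
    [C_4]-free, then the neighbours of a fixed vertex [u] have pairwise disjoint
    neighbourhoods outside [u], so [d(d-1) <= sc-1]; this fails for the
    parameters of the theorem and gives the upper bounds.

    The lower bounds come from three [C_4]-free graphs over the field [F] with
    [q] elements, edges inside a class being deleted each time.  On [F x F],
    join [(x,y)] to [(x',y')] when [y + y' = x x'], with classes [x = const];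
    on [F x S] with [S] a set of nonzero scalars, use the same adjacency
    ([x] ranging over [S]) with classes [y = const]; on the nonzero vectors of
    [F^2], join [u] to [v] when [u.v = 1], the classes being the [q + 1] lines
    through the origin. *)

(** * Common neighbours and degrees in [C4]-free graphs *)

Section C4Free.
Variables (V : finType) (h : rel V).
Hypothesis hG : simple_graph h.

Definition at_most_one_common_neighbor : Prop :=
  forall u z w w', u != z -> h u w -> h z w -> h u w' -> h z w' -> w = w'.

Lemma C4_of_common_neighbors u z w w' :
  u != z -> w != w' -> h u w -> h z w -> h u w' -> h z w' ->
  contains_copy h C4.
Proof.
move=> uz ww' uw zw uw' zw'; have [hsym hirr] := hG.
have neq x y : h x y -> x != y by apply: contraTneq => ->; rewrite hirr.
exists (tnth [tuple u; w; z; w']).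
  apply/tuple_uniqP; rewrite /= !inE !negb_or uz ww' (neq _ _ uw) (neq _ _ uw').
  by rewrite (neq _ _ zw') eq_sym (neq _ _ zw).
by move=> [[|[|[|[|//]]]] ?] [[|[|[|[|//]]]] ?] //= _;
  rewrite !(tnth_nth u) /= // hsym.
Qed.

Lemma no_C4_copy : at_most_one_common_neighbor -> ~ contains_copy h C4.
Proof.
move=> h1 [f finj fC]; have [hsym _] := hG.
pose o (i : nat) : 'I_4 := inord i.
have E (i j : nat) : i < 4 -> j < 4 ->
    (j == i.+1 %% 4) || (i == j.+1 %% 4) -> h (f (o i)) (f (o j)).
  by move=> i4 j4 ij; apply: fC; rewrite /C4 /= -!val_eqE /= !inordK.
have D (i j : nat) : i < 4 -> j < 4 -> i != j -> f (o i) != f (o j).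
  by move=> i4 j4 ij; rewrite inj_eq // -val_eqE /= !inordK.
(* Opposite vertices 0 and 2 of the cycle share the neighbours 1 and 3. *)
have := h1 (f (o 0)) (f (o 2)) (f (o 1)) (f (o 3)).
by rewrite !D ?E // => /(_ isT isT isT isT isT) /eqP; apply/negP/D.
Qed.

Lemma C4_free_degree_bound d (u : V) :
  at_most_one_common_neighbor ->
  (forall v, d <= #|[set w | h v w]|) -> d * d.-1 <= #|V|.-1.
Proof.
move=> h1 hd; have [hsym hirr] := hG.
(* Double counting of paths u, w, z with z != u: each of the at least d neighbours w of u extends to
   at least d - 1 vertices z. *)
have lb : d * d.-1 <= \sum_(w in [set w | h u w]) #|[set z | h w z] :\ u|.
  apply: leq_trans (_ : \sum_(w in [set w | h u w]) d.-1 <= _).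
    by rewrite sum_nat_const leq_mul.
  apply: leq_sum => w; rewrite inE => uw.
  by have := hd w; rewrite (cardsD1 u) inE hsym uw /=; lia.
apply: leq_trans lb _.
rewrite (eq_bigr (fun w => \sum_(z | z != u) (h w z : nat))); last first.
  move=> w _; rewrite -sum1_card big_mkcond [RHS]big_mkcond /=.
  by apply: eq_bigr => z _; rewrite !inE; case: (z != u); case: (h w z).
(* Summing over z first: the midpoints w are common neighbours of u and z, so each z is reached at
   most once. *)
rewrite exchange_big /= -(cardC1 u) -[X in _ <= X]sum1_card.
apply: leq_sum => z zu; rewrite -big_mkcondr sum1_card.
apply/card_le1_eqP => w w' /andP[+ wz] /andP[+ wz']; rewrite !inE => uw uw'.
by apply: (h1 u z); rewrite // 1?eq_sym // hsym.
Qed.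

End C4Free.

(** * Stars, degrees and the arrow relation *)

Lemma star_copyP (V : finType) (e : rel V) n : simple_graph e ->
  contains_copy e (@star n) <-> exists u, n <= #|[set v | e u v]|.
Proof.
move=> [e_sym eirr]; split=> [[f finj fS] | [u le_n]].
  exists (f ord0); pose g (j : 'I_n) := f (lift ord0 j).
  have ginj : injective g by move=> i j /finj /lift_inj.
  have := card_imset predT ginj; rewrite card_ord => {1}<-.
  apply/subset_leq_card/subsetP => _ /imsetP[j _ ->]; rewrite inE.
  exact: fS.
pose g (j : 'I_n) := enum_val (widen_ord le_n j).
have eg j : e u (g j) by have := enum_valP (widen_ord le_n j); rewrite inE.
have gu j : g j != u by apply: contraTneq (eg j) => ->; rewrite eirr.
have ginj : injective g by move=> i j /enum_val_inj /(congr1 val) /= /val_inj.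
exists (fun i => if unlift ord0 i is Some j then g j else u).
  move=> i k; case: unliftP => [j|] ->; case: unliftP => [l|] -> //.
  - by move/ginj->.
  - by move/eqP; rewrite (negPf (gu j)).
  - by move/esym/eqP; rewrite (negPf (gu l)).
move=> i k; rewrite /star /=; case: unliftP => [j|] ->; case: unliftP => [l|] ->;
  rewrite ?eqxx // ![_ == ord0]eq_sym ?(negPf (neq_lift _ _)) //= => _.
by rewrite e_sym.
Qed.

Section Multipartite.
Variables c s : nat.
Local Notation K := (@complete_multipartite c s).

Lemma simple_rel_complement h :
  subgraph h K -> simple_graph (rel_complement K h).
Proof.
case=> -[hsym _] _; rewrite /rel_complement /complete_multipartite.
split=> [x y|x] /=; last by rewrite eqxx.
by rewrite hsym eq_sym.
Qed.

Lemma degree_rel_complement h u : subgraph h K ->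
  #|[set v | h u v]| + #|[set v | rel_complement K h u v]| = s * c.-1.
Proof.
case=> _ hK; pose N := [set v | K u v].
have -> : s * c.-1 = #|N|.
  rewrite mulnC -[X in X.-1]card_ord -(cardsC1 u.1) -[X in _ * X]card_ord.
  rewrite -cardsT -cardsX; congr #|pred_of_set _|.
  by apply/setP => v; rewrite !inE andbT eq_sym.
rewrite -(cardsID [set v | h u v] N); congr (_ + _); apply: eq_card => v.
  by rewrite !inE; case: (boolP (h u v)) => [/hK->|]; rewrite ?andbF.
by rewrite !inE andbC.
Qed.

Lemma C4_star_arrow_of_degree n d : 0 < c -> 0 < s ->
  n + d <= (s * c.-1).+1 -> (s * c).-1 < d * d.-1 -> C4_star_arrow s n c.
Proof.
move=> c0 s0 lt_nd lt_d h hK; have hG := hK.1.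
have [/existsP E|/existsPn noS] :=
    boolP [exists u, n <= #|[set v | rel_complement K h u v]|].
  by right; apply/star_copyP => //; apply: simple_rel_complement.
(* Packing the four vertices into one finite type makes the search for a 4-cycle a boolean case
   split. *)
left; pose P (p : ('I_c * 'I_s) * ('I_c * 'I_s) *
               (('I_c * 'I_s) * ('I_c * 'I_s))) :=
  let: (u, z, (w, w')) := p in
  [&& u != z, w != w', h u w, h z w, h u w' & h z w'].
have [/existsP[[[u z] [w w']]]|/existsPn noC] := boolP [exists p, P p].
  by case/and5P=> uz ww' uw zw /andP[]; apply: (C4_of_common_neighbors hG uz ww').
have h1 : at_most_one_common_neighbor h.
  move=> u z w w' uz uw zw uw' zw'; apply/eqP/negPn/negP => ww'.
  by have := noC (u, z, (w, w')); rewrite /P uz ww' uw zw uw' zw'.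
have hd v : d <= #|[set w | h v w]|.
  by have := noS v; have := degree_rel_complement v hK; lia.
have := C4_free_degree_bound hG (Ordinal c0, Ordinal s0) h1 hd.
by rewrite card_prod !card_ord [c * s]mulnC leqNgt lt_d.
Qed.

(** The empty graph is a witness: its complement is all of K, where every degree is s(c-1). *)
Lemma not_C4_star_arrow_lt n : s * c.-1 < n -> ~ C4_star_arrow s n c.
Proof.
move=> lt_n; pose h : rel ('I_c * 'I_s) := [rel _ _ | false].
have hK : subgraph h K by split=> //; split.
case/(_ h hK) => [[f _ /(_ ord0 (ordS ord0) isT)]|] //.
case/(star_copyP _ (simple_rel_complement hK)) => u.
by have := degree_rel_complement u hK; lia.
Qed.

End Multipartite.

(** Deleting edges keeps common neighbours unique, so [g] may have loops and edges inside classes.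
    The degree hypothesis counts only edges between classes and leaves each vertex fewer than n
    non-neighbours in the other classes. *)
Lemma not_C4_star_arrow_of_graph (A B : finType) (g : rel (A * B)) n :
  symmetric g -> at_most_one_common_neighbor g ->
  (forall u, #|B| * #|A|.-1 < n + #|[set v | g u v && (u.1 != v.1)]|) ->
  ~ C4_star_arrow #|B| n #|A|.
Proof.
move=> gsym g1 gdeg.
pose phi (x : 'I_#|A| * 'I_#|B|) : A * B := (enum_val x.1, enum_val x.2).
have phi_inj : injective phi.
  by move=> [x y] [x' y'] [/enum_val_inj -> /enum_val_inj ->].
have phi_bij : bijective phi.
  by apply: inj_card_bij => //; rewrite !card_prod !card_ord.
pose h : rel ('I_#|A| * 'I_#|B|) :=
  [rel x y | g (phi x) (phi y) && (x.1 != y.1)].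
have hK : subgraph h (@complete_multipartite #|A| #|B|).
  split; first split.
  - by move=> x y; rewrite /h /= gsym eq_sym.
  - by move=> x; rewrite /h /= eqxx andbF.
  - by move=> x y /andP[].
have h1 : at_most_one_common_neighbor h.
  move=> u z w w' uz /andP[uw _] /andP[zw _] /andP[uw' _] /andP[zw' _].
  by apply/phi_inj/(g1 (phi u) (phi z)); rewrite // inj_eq.
case/(_ h hK) => [/(no_C4_copy hK.1 h1) //|].
case/(star_copyP _ (simple_rel_complement hK)) => u le_n.
have := degree_rel_complement u hK; have := gdeg (phi u).
suff -> : #|[set v | h u v]| = #|[set v | g (phi u) v && ((phi u).1 != v.1)]|.
  by lia.
rewrite -(on_card_preimset (onW_bij _ phi_bij)); apply: eq_card => v.
by rewrite !inE /h /= (inj_eq enum_val_inj).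
Qed.

Lemma leq_card_on (J T : finType) (P : {pred J}) (N : {pred T}) (f : J -> T) :
  {in P &, injective f} -> {in P, forall j, f j \in N} -> #|P| <= #|N|.
Proof.
move=> finj fN; rewrite -(card_in_imset finj).
by apply/subset_leq_card/subsetP => _ /imsetP[j Pj ->]; apply: fN.
Qed.

(** * The three graphs over a finite field *)

Section FieldGraphs.
Local Open Scope ring_scope.
Variable F : finFieldType.

(** Read (a, b) as the line Y = aX - b: two distinct points lie on at most one such line. *)
Lemma parabola_incidence_unique (x x' a a' y y' b b' : F) :
  y + b = x * a -> y' + b = x' * a -> y + b' = x * a' -> y' + b' = x' * a' ->
  (x, y) = (x', y') \/ (a, b) = (a', b').
Proof.
move=> e1 e2 e3 e4; have : (x - x') * (a - a') = 0.
  by rewrite mulrBl !mulrBr -e1 -e2 -e3 -e4; ring.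
move/eqP; rewrite mulf_eq0 !subr_eq0 => /orP[] /eqP E; [left | right].
  by move: e1; rewrite E -e2 => /addIr ->.
by move: e1; rewrite E -e3 => /addrI ->.
Qed.

Lemma not_C4_star_arrow_affine n :
  (#|F| * #|F|.-1 < n + #|F|.-1)%N -> ~ C4_star_arrow #|F| n #|F|.
Proof.
move=> lt_n; pose g : rel (F * F) := [rel u v | u.2 + v.2 == u.1 * v.1].
apply: (@not_C4_star_arrow_of_graph _ _ g).
- by move=> u v; rewrite /g /= addrC mulrC.
- move=> [x y] [x' y'] [a b] [a' b'] uz /eqP e1 /eqP e2 /eqP e3 /eqP e4.
  case: (parabola_incidence_unique e1 e2 e3 e4) => // E.
  by rewrite E eqxx in uz.
- move=> [x y]; apply: leq_trans lt_n _; rewrite leq_add2l -(cardC1 x).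
  (* Each class a contains a neighbour of (x, y); only the one with a = x is lost. *)
  apply: (@leq_card_on _ _ _ _ (fun a => (a, x * a - y))) => [a b _ _ [] //|a].
  by rewrite !inE /g /= addrC subrK eqxx eq_sym.
Qed.

Lemma not_C4_star_arrow_strip (B : finType) (e : B -> F) n :
  injective e -> (forall b, e b != 0) ->
  (#|B| * #|F|.-1 < n + #|B|.-1)%N -> ~ C4_star_arrow #|B| n #|F|.
Proof.
move=> einj e0 lt_n.
pose g : rel (F * B) := [rel u v | u.1 + v.1 == e u.2 * e v.2].
apply: (@not_C4_star_arrow_of_graph _ _ g).
- by move=> u v; rewrite /g /= addrC mulrC.
- move=> [y x] [y' x'] [b a] [b' a'] uz /eqP e1 /eqP e2 /eqP e3 /eqP e4.
  case: (parabola_incidence_unique e1 e2 e3 e4) => /= -[/einj-> -> //] in uz *.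
  by rewrite eqxx in uz.
- move=> [y x]; apply: leq_trans lt_n _; rewrite leq_add2l.
  (* Each scalar a yields one neighbour. It falls in the class of y only if [e x * e a = y + y],
     which holds for at most one a because [e x] is nonzero. *)
  pose P := [pred a | y != e x * e a - y].
  apply: (@leq_trans #|P|); last first.
    apply: (@leq_card_on _ _ _ _ (fun a => (e x * e a - y, a))) => [a b _ _ []|a] //.
    by rewrite !inE /g /= [y + _]addrC subrK eqxx.
  rewrite -(cardC P) -subn1 leq_subLR [(1 + _)%N]addnC leq_add2l.
  apply/card_le1_eqP => a b.
  rewrite !inE !negbK => /eqP {1}-> /eqP /addIr.
  by move/(mulfI (e0 x))/einj.
Qed.

(** One spanning vector for each of the q + 1 lines through the origin; [None] is the vertical
    line. *)
Definition line_direction (D : option F) : F * F :=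
  if D is Some m then (1, m) else (0, 1).

(** The orthogonal of a nonzero vector of the plane is a single line. *)
Lemma line_direction_orthogonal_unique (a b : F) D D' :
  (a != 0) || (b != 0) ->
  a * (line_direction D).1 + b * (line_direction D).2 = 0 ->
  a * (line_direction D').1 + b * (line_direction D').2 = 0 -> D = D'.
Proof.
move=> ab0; case: D D' => [m|] [m'|] //=; rewrite ?mulr0 ?mulr1 ?add0r.
- move=> e1 e2; congr Some; apply/eqP; rewrite -subr_eq0; move: ab0.
  apply: contraTT => mm'.
  have /eqP : b * (m - m') = 0.
    transitivity ((a + b * m) - (a + b * m')); first by ring.
    by rewrite e1 e2 subrr.
  rewrite mulf_eq0 (negPf mm') orbF => /eqP b0.
  by move: e1; rewrite b0 mul0r addr0 => ->; rewrite !eqxx.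
- by move=> e1 e2; move: ab0 e1; rewrite e2 eqxx mul0r addr0 orbF => /eqP.
- by move=> e1 e2; move: ab0 e2; rewrite e1 eqxx mul0r addr0 orbF => /eqP.
Qed.

(** The vector (a - c, b - d) is orthogonal to (p, r) and (p', r'), so it vanishes if their
    determinant does not. Otherwise these two are parallel, and having the same product 1 with (a,
    b) they coincide. *)
Lemma dot_incidence_unique (a b c d p r p' r' : F) :
  a * p + b * r = 1 -> c * p + d * r = 1 ->
  a * p' + b * r' = 1 -> c * p' + d * r' = 1 ->
  (a, b) = (c, d) \/ (p, r) = (p', r').
Proof.
move=> e1 e2 e3 e4.
have /eqP : (a - c) * (p * r' - p' * r) = 0.
  transitivity (r' * ((a * p + b * r) - (c * p + d * r)) -
                r * ((a * p' + b * r') - (c * p' + d * r'))); first by ring.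
  by rewrite e1 e2 e3 e4 subrr !mulr0 subrr.
have /eqP : (b - d) * (p * r' - p' * r) = 0.
  transitivity (p * ((a * p' + b * r') - (c * p' + d * r')) -
                p' * ((a * p + b * r) - (c * p + d * r))); first by ring.
  by rewrite e1 e2 e3 e4 subrr !mulr0 subrr.
rewrite !mulf_eq0 !subr_eq0.
case: (eqVneq (p * r') (p' * r)) => [E _ _|_]; last first.
  by rewrite !orbF => /eqP-> /eqP->; left.
right; congr pair.
- transitivity (a * p * p' + b * (p * r')); last by rewrite E -[RHS]mul1r -e1; ring.
  by rewrite -[LHS]mul1r -e3; ring.
- transitivity (a * (p' * r) + b * r * r'); last by rewrite -E -[RHS]mul1r -e1; ring.
  by rewrite -[LHS]mul1r -e3; ring.
Qed.

Lemma not_C4_star_arrow_punctured_plane n :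
  (#|F|.-1 * #|F| < n + #|F|.-1)%N -> ~ C4_star_arrow #|F|.-1 n #|F|.+1.
Proof.
move=> lt_n; pose B : finType := {t : F | t != 0}.
have cB : #|B| = #|F|.-1 by rewrite card_sig -(cardC1 0).
pose vec (u : option F * B) : F * F :=
  (val u.2 * (line_direction u.1).1, val u.2 * (line_direction u.1).2).
have vec0 u : ((vec u).1 != 0) || ((vec u).2 != 0).
  by case: u => [[m|] [t t0]]; rewrite /= !mulr1 t0 ?orbT.
have vec_inj : injective vec.
  move=> [[m|] [t t0]] [[m'|] [t' t0']]; rewrite /vec /= !(mulr1, mulr0) => -[].
  - move=> E; subst t'; move/(mulfI t0) => ->.
    by congr pair; apply: val_inj.
  - by move=> E; case/eqP: (t0).
  - by move=> E; case/eqP: (t0').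
  - by move=> E; congr pair; apply: val_inj.
pose g : rel (option F * B) :=
  [rel u v | (vec u).1 * (vec v).1 + (vec u).2 * (vec v).2 == 1].
rewrite -card_option -cB; apply: (@not_C4_star_arrow_of_graph _ _ g).
- by move=> u v; rewrite /g /= ![_ * (vec v).1]mulrC ![_ * (vec v).2]mulrC.
- move=> u z w w' uz /eqP e1 /eqP e2 /eqP e3 /eqP e4.
  have := dot_incidence_unique e1 e2 e3 e4; rewrite -!surjective_pairing.
  by case=> /vec_inj // E; rewrite E eqxx in uz.
- move=> u; rewrite cB card_option /=; apply: leq_trans lt_n _.
  rewrite leq_add2l.
  (* A line D with [l D != 0] contains the neighbour of u obtained by scaling its direction by the
     inverse of [l D]. At most one line is orthogonal to u, and dropping the class of u leaves at
     least q - 1 lines. *)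
  pose l D := (vec u).1 * (line_direction D).1 + (vec u).2 * (line_direction D).2.
  pose P := [set D | l D != 0].
  have cP : (#|F| <= #|P|)%N.
    rewrite -ltnS -card_option -(cardsC P) -addn1 leq_add2l.
    apply/card_le1_eqP => D D'; rewrite !inE !negbK => /eqP l0 /eqP l0'.
    exact: line_direction_orthogonal_unique (vec0 u) l0' l0.
  apply: (@leq_trans #|P :\ u.1|).
    by have := cardsD1 u.1 P; case: (_ \in P); lia.
  have one0 : (1 : F) != 0 by apply: oner_neq0.
  (* The default scalar 1 is never reached on [P], where [l D] is invertible. *)
  pose f D : option F * B := (D, insubd (Sub 1 one0) (l D)^-1).
  apply: (@leq_card_on _ _ _ _ f) => [D D' _ _ [] //|D].
  rewrite !inE eq_sym => /andP[-> lD]; rewrite andbT /g /=.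
  rewrite val_insubd invr_eq0 lD; apply/eqP.
  by rewrite ![_^-1 * _]mulrC !mulrA -mulrDl divff.
Qed.

End FieldGraphs.

(** * Choice of degrees and final arithmetic *)

Theorem theoremE (q : nat) (hq : prime_power q) :
  (5 <= q -> forall k : nat, k <= q %/ 2 - 1 ->
     is_M (q - k) ((q - k) * (q - 2) + 2) (q + 1)) /\
  (3 <= q -> is_M (q - 1) ((q - 1) ^ 2 + 1) (q + 2)).
Proof.
case: hq => p [m [p_pr m0 qE]].
have [F _ cF] := pPrimePowerField p_pr m0; rewrite -qE in cF.
split=> [q5 k kq | q3].
  (* With s = q - k = r + 2, the bound on k becomes q <= 2s - 2. *)
  have [r [sE r0 rq]] : exists r, [/\ q - k = r.+2, q <= r.*2 + 2 & r.+2 <= q].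
    by exists (q - k - 2); split; lia.
  have [t tE] : exists t, q = t.+2 by exists (q - 2); lia.
  rewrite sE; split; first by lia.
    (* Here d = sq + 1 - n = 2s - 1. *)
    apply: (@C4_star_arrow_of_degree _ _ _ (r.*2 + 3)); try lia; nia.
  move=> c' c0 arr; rewrite leqNgt addn1 ltnS; apply/negP => c'q.
  (* Below q classes the empty graph suffices, since s(q-2) < n; only c' = q needs a field graph. *)
  have [c'ltq | qlec'] := ltnP c' q.
    by apply: not_C4_star_arrow_lt arr; nia.
  have {c'q qlec' c0} E : c' = q by lia.
  rewrite {c'}E in arr.
  (* For k = 0 there are not enough nonzero scalars for the strip, and the full affine graph is
     used. *)
  case: (posnP k) => [k0|k0].
    have Er : r.+2 = q by lia.
    rewrite Er -cF in arr; apply: not_C4_star_arrow_affine arr.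
    by rewrite cF; nia.
  have le_s : r.+2 <= #|[set~ (0%R : F)]| by rewrite cardsC1 cF; lia.
  pose e (i : 'I_r.+2) : F := enum_val (widen_ord le_s i).
  have einj : injective e by move=> i j /enum_val_inj /(congr1 val) /= /val_inj.
  have e0 i : e i != 0%R by have := enum_valP (widen_ord le_s i); rewrite !inE.
  apply: (@not_C4_star_arrow_strip F _ e ((r.+2 * (q - 2)) + 2) einj e0).
    by rewrite card_ord cF; nia.
  by rewrite card_ord cF.
have [t tE] : exists t, q = t.+3 by exists (q - 3); lia.
split; first by lia.
  (* With q = t + 3, d = (q-1)(q+1) + 1 - n = 2(q-1). *)
  by apply: (@C4_star_arrow_of_degree _ _ _ (t.*2 + 4)); rewrite ?tE; try lia; nia.
move=> c' c0 arr; rewrite leqNgt addn2 ltnS; apply/negP => c'q.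
(* Up to q classes all degrees are at most (q-1)^2 < n, which leaves c' = q + 1. *)
have [c'ltq | qlec'] := leqP c' q.
  by apply: not_C4_star_arrow_lt arr; rewrite tE in c'ltq *; nia.
have {c'q qlec' c0} E : c' = #|F|.+1 by lia.
rewrite {c'}E subn1 -cF in arr; apply: not_C4_star_arrow_punctured_plane arr.
by rewrite cF tE; nia.
Qed.
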